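(* Let $G$ and $G'$ be finitely generated groups with $H_1(G;\mathbb{Z})\cong H_1(G';\mathbb{Z})$. Then $$|a(G)-a(G')|\leq d_P(G,G')\leq r(G)+r(G')+r(H_1(G;\mathbb{Z}))\,\bigl(r(H_1(G;\mathbb{Z}))-3\bigr).$$
   Context: $H_1(G;\mathbb{Z})=G/[G,G]$ is the abelianization. The Ma-Qiu index $a(G)$ of a group $G$ is the minimum number of elements of the commutator subgroup $[G,G]$ whose normal closure in $G$ equals $[G,G]$. The rank $r(G)$ is the minimum number of generators of $G$. For a generating set $S$ of a group $G$, an element $r$ of the free group $\langle S\rangle$ is null-homologous in $G$ if $\pi_G(r)\in[G,G]$, where $\pi_G:\langle S\rangle\to G$ is the natural projection. For a presentation $\langle S\mid R\rangle$ of a group $G$, a relator replacement replaces a relator $r\in R$ with another relator $r'\in\langle S\rangle$, giving the presentation $\langle S\mid R\setminus\{r\},r'\rangle$ of another group $G'$. (Any presentation of $G$ may be used, for instance one containing the trivial relator; groups are considered up to isomorphism, and the presentation may be changed between successive replacements.) The relator replacement is null-homologous if $r$ is null-homologous in $G'$ and $r'$ is null-homologous in $G$. For groups $G,G'$ with $H_1(G;\mathbb{Z})\cong H_1(G';\mathbb{Z})$, the presentation distance $d_P(G,G')$ is the minimum number of null-homologous relator replacements needed to convert $G$ to $G'$. *)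

(* Defs.v *)
(* Groups are the possibly infinite [groupType]s; subsets are classical. *)
From HB Require Import structures.
From Stdlib Require Import Relation_Operators.
From mathcomp Require Import all_boot finmap.
From mathcomp Require Import boolp classical_sets.
Set Implicit Arguments.
Unset Strict Implicit.
Unset Printing Implicit Defensive.

Local Open Scope classical_set_scope.
Local Open Scope group_scope.
Local Open Scope quotient_scope.

Section Subgroups.
Variable G : groupType.
Implicit Types A N : set G.

Definition is_subgroup N : Prop :=
  [/\ N 1, forall x y, N x -> N y -> N (x * y) & forall x, N x -> N x^-1].

Definition is_normal N : Prop :=
  is_subgroup N /\ forall x g, N x -> N (x ^ g).

Record normal_subgroup := NormalSubgroup {
  normal_carrier :> set G;
  normalP : is_normal normal_carrier
}.

Definition generated_subgroup A : set G := smallest is_subgroup A.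

Lemma subgroup_smallest (C : set (set G)) A :
  C `<=` is_subgroup -> is_subgroup (smallest C A).
Proof.
move=> Csub; split=> [M [/Csub[M1 _ _] _] //|x y Ax Ay M CM|x Ax M CM].
  by have [/Csub[_ MM _] _] := CM; apply: MM; [exact: (Ax _ CM)|exact: (Ay _ CM)].
by have [/Csub[_ _ MV] _] := CM; exact: (MV _ (Ax _ CM)).
Qed.

Lemma normal_smallest_normal A : is_normal (smallest is_normal A).
Proof.
split; first by apply: subgroup_smallest => M [].
by move=> x g Ax M CM; have [[_ MJ] _] := CM; exact: (MJ _ _ (Ax _ CM)).
Qed.

Definition normal_closure A : normal_subgroup :=
  NormalSubgroup (normal_smallest_normal A).

Definition commutators : set G := [set z | exists x y : G, z = [~ x, y]].

Lemma normal_commutators : is_normal (generated_subgroup commutators).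
Proof.
split; first exact: subgroup_smallest.
move=> x g Dx M [[M1 MM MV] sM].
have : is_subgroup [set z | M (z ^ g)].
  split=> [|y z|y] /=; first by rewrite conj1g.
  - by rewrite conjMg; exact: MM.
  - by rewrite conjVg; exact: MV.
move=> sub; apply: (Dx [set z | M (z ^ g)]); split=> // _ [y [z ->]] /=.
by apply: sM; exists (y ^ g), (z ^ g); rewrite conjRg.
Qed.

Definition commutator_subgroup : normal_subgroup :=
  NormalSubgroup normal_commutators.

End Subgroups.

Section Quotients.
Variables (G : groupType) (N : normal_subgroup G).

Definition coset_rel : rel G := fun x y => `[< normal_carrier N (x^-1 * y) >].

Lemma coset_relP : equiv_class_of coset_rel.
Proof.
have [[N1 NM NV] _] := normalP N; split=> [x|x y|y x z].
- by apply/asboolP; rewrite mulVg.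
- by apply/asboolP/asboolP => /NV; rewrite invgM invgK.
- move=> /asboolP xy /asboolP yz; apply/asboolP.
  by have := NM _ _ xy yz; rewrite -mulgA mulVKg.
Qed.

Canonical coset_equiv := EquivRelPack coset_relP.

Definition quotient_group := {eq_quot coset_equiv}.
HB.instance Definition _ := Choice.on quotient_group.

Definition quotient_proj (x : G) : quotient_group := \pi x.

Let quo_mul (X Y : quotient_group) := quotient_proj (repr X * repr Y).
Let quo_inv (X : quotient_group) := quotient_proj (repr X)^-1.

Lemma quotient_projP x y :
  quotient_proj x = quotient_proj y <-> normal_carrier N (x^-1 * y).
Proof.
split=> [/eqmodP/asboolP//|Nxy]; exact/eqmodP/asboolP.
Qed.

Let repr_proj x : normal_carrier N (x^-1 * repr (quotient_proj x)).
Proof. by apply/quotient_projP; rewrite /quotient_proj reprK. Qed.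

Let proj_repr X : quotient_proj (repr X) = X.
Proof. exact: reprK. Qed.

Let quo_mulE x y :
  quo_mul (quotient_proj x) (quotient_proj y) = quotient_proj (x * y).
Proof.
have [[_ NM _] NJ] := normalP N; symmetry; apply/quotient_projP.
set x' := repr _; set y' := repr _.
have -> : (x * y)^-1 * (x' * y') = (x^-1 * x') ^ y * (y^-1 * y').
  by rewrite invgM /conjg !mulgA mulgK.
by apply: NM; [apply: NJ|]; exact: repr_proj.
Qed.

Let quo_invE x : quo_inv (quotient_proj x) = quotient_proj x^-1.
Proof.
have [[_ _ NV] NJ] := normalP N; apply/quotient_projP.
rewrite invgK; set x' := repr _.
have -> : x' * x^-1 = (x^-1 * x') ^ x^-1 by rewrite /conjg invgK !mulgA mulgV mul1g.
by apply: NJ; exact: repr_proj.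
Qed.

Let quo_mulA : associative quo_mul.
Proof.
move=> X Y Z; rewrite -(proj_repr X) -(proj_repr Y) -(proj_repr Z).
by rewrite !quo_mulE mulgA.
Qed.
Let quo_mul1 : left_id (quotient_proj 1) quo_mul.
Proof. by move=> X; rewrite -(proj_repr X) quo_mulE mul1g. Qed.
Let quo_1mul : right_id (quotient_proj 1) quo_mul.
Proof. by move=> X; rewrite -(proj_repr X) quo_mulE mulg1. Qed.
Let quo_mulV : left_inverse (quotient_proj 1) quo_inv quo_mul.
Proof. by move=> X; rewrite -(proj_repr X) quo_invE quo_mulE mulVg. Qed.
Let quo_Vmul : right_inverse (quotient_proj 1) quo_inv quo_mul.
Proof. by move=> X; rewrite -(proj_repr X) quo_invE quo_mulE mulgV. Qed.

HB.instance Definition _ := isGroup.Build quotient_group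
  quo_mulA quo_mul1 quo_1mul quo_mulV quo_Vmul.

Lemma quotient_projM x y :
  quotient_proj (x * y) = quotient_proj x * quotient_proj y.
Proof. by rewrite -quo_mulE. Qed.

HB.instance Definition _ :=
  isMultiplicative.Build G quotient_group quotient_proj quotient_projM.
HB.instance Definition _ :=
  Multiplicative_isUMagmaMorphism.Build G quotient_group quotient_proj
    (erefl (quotient_proj 1)).

End Quotients.

Section FreeGroups.
Variable S : choiceType.

(* The letter (s, false) stands for s, and (s, true) for s^-1. *)
Let word := seq (S * bool).
Let flip (a : S * bool) : S * bool := (a.1, ~~ a.2).

Definition word_cancel (w w' : word) : Prop :=
  exists u v a, w = u ++ [:: a; flip a] ++ v /\ w' = u ++ v.

Definition word_rel : rel word :=
  fun w w' => `[< clos_refl_sym_trans word word_cancel w w' >].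

Lemma word_relP : equiv_class_of word_rel.
Proof.
split=> [w|w w'|w' w w''].
- by apply/asboolP/rst_refl.
- by apply/asboolP/asboolP; exact: rst_sym.
- by move=> /asboolP ? /asboolP ?; apply/asboolP/(rst_trans _ _ _ w').
Qed.

Canonical word_equiv := EquivRelPack word_relP.

Definition free_group := {eq_quot word_equiv}.
HB.instance Definition _ := Choice.on free_group.

Definition free_word (w : word) : free_group := \pi w.
Definition free_gen (s : S) : free_group := free_word [:: (s, false)].

Let free_mul (x y : free_group) := free_word (repr x ++ repr y).
Let free_inv (x : free_group) := free_word (rev (map flip (repr x))).

Lemma free_wordP w w' :
  free_word w = free_word w' <-> clos_refl_sym_trans word word_cancel w w'.
Proof. by split=> [/eqmodP/asboolP//|ww']; exact/eqmodP/asboolP. Qed.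

Let repr_word w : clos_refl_sym_trans word word_cancel w (repr (free_word w)).
Proof. by apply/free_wordP; rewrite /free_word reprK. Qed.

Let word_repr x : free_word (repr x) = x.
Proof. exact: reprK. Qed.

Let flipK : involutive flip.
Proof. by case=> s b; rewrite /flip /= negbK. Qed.

Let rst_map (f : word -> word) w w' :
    (forall u v, word_cancel u v -> word_cancel (f u) (f v)) ->
  clos_refl_sym_trans word word_cancel w w' ->
  clos_refl_sym_trans word word_cancel (f w) (f w').
Proof.
move=> fc; elim=> [u v /fc|u|u v _|u v z _ IH1 _ IH2].
- exact: rst_step.
- exact: rst_refl.
- exact: rst_sym.
- exact: rst_trans IH1 IH2.
Qed.

Let free_mulE w w' : free_mul (free_word w) (free_word w') = free_word (w ++ w').
Proof.
apply/free_wordP/rst_sym; apply: (rst_trans _ _ _ (repr (free_word w) ++ w')).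
  apply: (rst_map (f := cat^~ w')) (repr_word w) => _ _ [u [v [a [-> ->]]]].
  by exists u, (v ++ w'), a; rewrite -!catA.
apply: (rst_map (f := cat _)) (repr_word w') => _ _ [u [v [a [-> ->]]]].
by exists (repr (free_word w) ++ u), v, a; rewrite -!catA.
Qed.

Let free_invE w : free_inv (free_word w) = free_word (rev (map flip w)).
Proof.
apply/free_wordP/rst_sym.
apply: (rst_map (f := fun w => rev (map flip w))) (repr_word w).
move=> _ _ [u [v [a [-> ->]]]]; exists (rev (map flip v)), (rev (map flip u)), a.
by rewrite !map_cat !rev_cat /= flipK /rev /= -!catA.
Qed.

Let free_mulA : associative free_mul.
Proof.
move=> x y z; rewrite -(word_repr x) -(word_repr y) -(word_repr z).
by rewrite !free_mulE catA.
Qed.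
Let free_mul1 : left_id (free_word [::]) free_mul.
Proof. by move=> x; rewrite -(word_repr x) free_mulE. Qed.
Let free_1mul : right_id (free_word [::]) free_mul.
Proof. by move=> x; rewrite -(word_repr x) free_mulE cats0. Qed.
Let free_Vmul : right_inverse (free_word [::]) free_inv free_mul.
Proof.
move=> x; rewrite -(word_repr x) free_invE free_mulE; apply/free_wordP.
elim/last_ind: (repr x) => [|w a IH]; first exact: rst_refl.
rewrite map_rcons rev_rcons -cats1 -catA; apply: rst_trans IH.
by apply: rst_step; exists w, (rev (map flip w)), a.
Qed.
Let free_mulV : left_inverse (free_word [::]) free_inv free_mul.
Proof.
move=> x; rewrite -{2}(word_repr x).
have -> : free_word (repr x) = free_inv (free_inv x).
  rewrite -{2}(word_repr x) !free_invE map_rev revK -map_comp.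
  by rewrite (eq_map flipK) map_id.
exact: free_Vmul.
Qed.

HB.instance Definition _ := isGroup.Build free_group
  free_mulA free_mul1 free_1mul free_mulV free_Vmul.

Lemma free_wordM w w' : free_word w * free_word w' = free_word (w ++ w').
Proof. exact: free_mulE. Qed.

Lemma free_wordV w :
  (free_word w)^-1 = free_word (rev [seq (a.1, ~~ a.2) | a <- w]).
Proof. exact: free_invE. Qed.

Lemma free_group_lift (G : groupType) (g : S -> G) :
  exists f : {multiplicative free_group -> G}, forall s, f (free_gen s) = g s.
Proof.
pose ev (w : word) :=
  foldr (fun a x => (if a.2 then (g a.1)^-1 else g a.1) * x) 1 w.
have ev_cat u v : ev (u ++ v) = ev u * ev v.
  by elim: u => [|a u IH] /=; rewrite ?mul1g // IH mulgA.
have evE w w' : clos_refl_sym_trans word word_cancel w w' -> ev w = ev w'.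
  elim=> [u v [x [y [[s b] [-> ->]]]]|//|//|x y z _ IH1 _ IH2]; last first.
    by rewrite IH1.
  by rewrite !ev_cat /=; congr (_ * _); case: b; rewrite /= ?mulKg ?mulVKg ?mul1g.
pose f (x : free_group) := ev (repr x).
have fE w : f (free_word w) = ev w by apply/esym/evE/repr_word.
have fM : {morph f : x y / x * y}.
  by move=> x y; rewrite -(word_repr x) -(word_repr y) free_wordM !fE ev_cat.
pose mf := isMultiplicative.Build free_group G f fM.
pose F : {multiplicative free_group -> G} := HB.pack f mf.
by exists F => s; rewrite [LHS]fE /= mulg1.
Qed.

End FreeGroups.

Definition isomorphic (G H : groupType) : Prop :=
  exists f : {multiplicative G -> H}, bijective f.

Definition abelianization (G : groupType) : groupType :=
  quotient_group (commutator_subgroup G).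

Definition presented_group (S : choiceType) (R : set (free_group S)) : groupType :=
  quotient_group (normal_closure R).

Definition null_homologous (S : choiceType) (R : set (free_group S))
    (r : free_group S) : Prop :=
  normal_carrier (commutator_subgroup (presented_group R))
    (quotient_proj (normal_closure R) r).

(* The generating set [S] and the relator set [R] may be infinite, and [R] may
   contain the trivial relator [1]. *)
Definition null_homologous_replacement (G G' : groupType) : Prop :=
  exists (S : choiceType) (R : set (free_group S)) (r r' : free_group S),
  let R' := (R `\ r) `|` [set r'] in
  [/\ R r,
      isomorphic G (presented_group R), isomorphic G' (presented_group R'),
      null_homologous R' r & null_homologous R r'].

Fixpoint converts_in (n : nat) (G G' : groupType) : Prop :=
  if n is m.+1 then
    exists2 G1 : groupType, null_homologous_replacement G G1 &
                            converts_in m G1 G'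
  else isomorphic G G'.

Definition is_minimum (P : set nat) (n : nat) : Prop :=
  P n /\ forall m, P m -> (n <= m)%N.

Definition finitely_generated (G : groupType) : Prop :=
  exists A : {fset G}, generated_subgroup [set` A] = [set: G].

Definition is_rank (G : groupType) : nat -> Prop :=
  is_minimum [set n | exists2 A : {fset G}, #|` A|%fset = n &
                      generated_subgroup [set` A] = [set: G]].

Definition is_MaQiu_index (G : groupType) : nat -> Prop :=
  is_minimum [set n | exists A : {fset G},
    [/\ #|` A|%fset = n, [set` A] `<=` commutator_subgroup G &
        normal_closure [set` A] = commutator_subgroup G :> set G]].

Definition is_presentation_distance (G G' : groupType) : nat -> Prop :=
  is_minimum [set n | converts_in n G G'].

(* Main.v *)
Require Import Defs.
From HB Require Import structures.
From mathcomp Require Import all_boot all_order all_algebra.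
From mathcomp Require Import finmap zify boolp classical_sets.
Import Order.TTheory GRing.Theory Num.Theory.
Set Implicit Arguments.
Unset Strict Implicit.
Unset Printing Implicit Defensive.

(** Write D(G) for the commutator subgroup and h for the rank of the common
abelianization.  Everything rests on reading a null-homologous replacement
without presentations: if K is presented by the relators that r and r' leave
untouched, then G = K / <<u>> and G' = K / <<v>> for the images u, v of r, r'
in K, and the homological conditions say that u dies in the abelianization of
G' and v in that of G.  Conversely every such triple (K, u, v) comes from a
replacement ([linked_of_replacement], [replacement_of_linked]).  In this form
the relation is visibly symmetric, so the presentation distance is a symmetric
path length.

Lower bound.  If D(G) is the normal closure of s elements, lift them to D(K);
together with u they normally generate a subgroup containing D(K), and their
images normally generate D(G').  So one replacement changes the Ma-Qiu index by
at most one ([MaQiu_linked]).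

Upper bound.  Killing one by one a(G) elements that normally generate D(G) is a
path of a(G) replacements from G to its abelianization, where K is at each step
the group reached so far ([converts_in_abelianization]).  Joining two such paths
at the common abelianization bounds the distance from G to G' by a(G) + a(G').
It remains to see that a(G) <= r(G) - h + h(h-1)/2 ([MaQiu_bound]).  If G is
generated by s_1, ..., s_h and by elements t_1, ..., t_(r-h) of D(G), then D(G)
is the normal closure of the t_i and of the [s_i, s_j] with i < j, because
killing these makes the generators commute ([MaQiu_of_generators]).

Such generators are reached from arbitrary ones by Nielsen moves, as long as
more than h generators survive in the abelianization ([nielsen_zero]).  Among
all tuples of images obtained by moves, and all integral relations between
their entries, take a nonzero coefficient d of least absolute value, or d = 0
if there are only trivial relations.  Division
with remainder produces a tuple x with d x_i = 0 for which d divides every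
coefficient of every relation.  Writing x through h generators and these back
through x factors the identity matrix of size n > h modulo d through size h,
which forces d = 1 or -1 and hence x_i = 0. *)

Local Open Scope ring_scope.

(** * Relations between elements of an abelian group *)

Lemma intr_Fp_eq0 p (z : int) : prime p -> (p%:Z %| z)%Z -> z%:~R = 0 :> 'F_p.
Proof.
move=> p_pr /dvdzP[q ->].
by rewrite intrM -pmulrn pchar_Fp_0 ?mulr0.
Qed.

(** Modulo a prime divisor of d, the identity of size n would have rank at most
h.  The case d = 0 is included, with an arbitrary prime. *)
Lemma factor_identity_mod n h (M : 'M[int]_(n, h)) (N : 'M[int]_(h, n)) (d : int) :
  (h < n)%N -> (forall i j, (d %| (M *m N - 1%:M) i j)%Z) -> `|d|%N = 1%N.
Proof.
move=> hn dMN; apply/eqP/negPn/negP => d1.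
have [p p_pr pd] : exists2 p, prime p & (p%:Z %| d)%Z.
  have [->|d0] := eqVneq d 0; first by exists 2%N.
  exists (pdiv `|d|%N); last by rewrite dvdzE pdiv_dvd.
  by rewrite pdiv_prime // ltn_neqAle eq_sym d1 absz_gt0.
have MN1 : map_mx intr M *m map_mx intr N = 1%:M :> 'M['F_p]_n.
  apply/eqP; rewrite -subr_eq0 -map_mxM -(map_mx1 intr) -map_mxB.
  apply/eqP/matrixP => i j; rewrite [RHS]mxE.
  transitivity (((M *m N - 1%:M) i j)%:~R : 'F_p).
    by rewrite [LHS]mxE.
  apply: intr_Fp_eq0 => //.
  exact: dvdz_trans pd (dMN i j).
have := mulmx_max_rank (map_mx intr M : 'M['F_p]_(n, h)) (map_mx intr N).
by rewrite MN1 mxrank1 leqNgt hn.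
Qed.

Section Tuples.
Variable A : zmodType.

Definition lincomb n (x : 'I_n -> A) (c : 'I_n -> int) : A := \sum_i x i *~ c i.

Definition nielsen_move n (x : 'I_n -> A) i (k : 'I_n -> int) : 'I_n -> A :=
  fun l => if l == i then x i + \sum_(j | j != i) x j *~ k j else x l.

(** The change of coefficients dual to a move: adding k_j x_j to x_i is
compensated by subtracting k_j c_i from c_j. *)
Lemma lincomb_nielsen_move n (x : 'I_n -> A) i (c k : 'I_n -> int) :
  lincomb (nielsen_move x i k) (fun j => if j == i then c i else c j - k j * c i)
  = lincomb x c.
Proof.
rewrite /lincomb (bigD1 i) // [RHS](bigD1 i) //= /nielsen_move eqxx.
rewrite mulrzDl -addrA mulrz_suml -big_split /=; congr (_ + _).
by apply: eq_bigr => j /negPf ji; rewrite ji mulrzBr mulrzA addrC subrK.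
Qed.

Section Reduction.
Variables (n : nat) (P : ('I_n -> A) -> Prop).
Hypothesis Pmove : forall x i k, P x -> P (nielsen_move x i k).

(** The move whose coefficients are the quotients c_j %/ a replaces each c_j by
its remainder modulo a, which vanishes by the minimality of a. *)
Lemma clear_relation x c i (a := c i) :
    P x -> lincomb x c = 0 -> a != 0 ->
    (forall y e j, P y -> lincomb y e = 0 -> (`|e j| < `|a|)%N -> e j = 0) ->
  (forall j, (a %| c j)%Z) /\ exists2 y, P y & y i *~ a = 0.
Proof.
move=> Px xc a0 amin.
pose k j := (c j %/ a)%Z; pose y := nielsen_move x i k.
pose e j := if j == i then a else c j - k j * a.
have ye : lincomb y e = 0 by rewrite -xc -(lincomb_nielsen_move x i c k).
have eE j : j != i -> e j = (c j %% a)%Z.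
  by move=> /negPf ji; rewrite /e ji {1}(divz_eq (c j) a) addrC addKr.
have e0 j : j != i -> e j = 0.
  move=> ji; apply: (amin y) => //; first exact: Pmove.
  by rewrite eE // -ltz_nat abszE ger0_norm ?modz_ge0 // ltz_mod.
split=> [j|].
  have [->|ji] := eqVneq j i; first exact: dvdzz.
  by apply/dvdz_mod0P; rewrite -eE // e0.
exists y; first exact: Pmove.
move: ye; rewrite /lincomb (bigD1 i) //= big1 ?addr0 => [|j ji].
  by rewrite /e eqxx.
by rewrite e0.
Qed.

(** If the tuples of P satisfy no nontrivial relation, d = 0 will do.  Otherwise
d is a least nonzero coefficient, made the only one of its relation by
[clear_relation].  In any other relation the coefficient at i is a multiple of
d, again by minimality, so it can be changed to d itself; then [clear_relation]
applies to that relation. *)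
Lemma reduced_tuple : (0 < n)%N -> (exists x, P x) ->
  exists x i (d : int), [/\ P x, x i *~ d = 0 &
    forall c j, lincomb x c = 0 -> (d %| c j)%Z].
Proof.
move=> n0 [x Px].
pose Q m := exists y c j, [/\ P y, lincomb y c = 0, `|c j|%N = m & c j != 0].
have [[m Qm]|nQ] := pselect (exists m, Q m); last first.
  exists x, (Ordinal n0), 0; split=> //.
  move=> c j xc; rewrite dvd0z; apply: contra_notT nQ => cj0.
  by exists `|c j|%N, x, c, j.
have exQ : exists m, `[< Q m >] by exists m; apply/asboolP.
case: (ex_minnP exQ) => {Qm}m /asboolP[y [c [i [Py yc ci c0]]]] mmin.
have amin z e j : P z -> lincomb z e = 0 -> (`|e j| < `|c i|)%N -> e j = 0.
  move=> Pz ze; rewrite ltnNge => lt; apply/eqP; apply: contraNT lt => e0.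
  by rewrite ci; apply: mmin; apply/asboolP; exists z, e, j.
have [_ [z Pz zi]] := clear_relation Py yc c0 amin.
exists z, i, (c i); split=> // e j ze.
pose upd b l := if l == i then b else e l.
have updE b : z i *~ b = z i *~ e i -> lincomb z (upd b) = 0.
  move=> zb; rewrite -ze /lincomb (bigD1 i) // [RHS](bigD1 i) //= /upd eqxx zb.
  by congr (_ + _); apply: eq_bigr => l /negPf ->.
(* d annihilates z i, so the coefficient e i may be reduced modulo d. *)
have zmod0 : z i *~ e i = z i *~ (e i %% c i)%Z.
  by rewrite {1}(divz_eq (e i) (c i)) mulrzDr mulrC mulrzA zi mul0rz add0r.
have ei0 : (e i %% c i)%Z = 0.
  have := amin z (upd (e i %% c i)%Z) i Pz (updE _ (esym zmod0)).
  rewrite /upd eqxx; apply.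
  by rewrite -ltz_nat abszE ger0_norm ?modz_ge0 // ltz_mod.
have zc : z i *~ c i = z i *~ e i by rewrite zi zmod0 ei0.
have updi : upd (c i) i = c i by rewrite /upd eqxx.
have := @clear_relation z (upd (c i)) i Pz (updE _ zc).
rewrite updi => /(_ c0 amin)[/(_ j) + _].
by rewrite /upd; case: eqP => // -> _; apply/dvdz_mod0P.
Qed.

(** The rows of M N - 1 are relations between the entries of x, where M expresses
x through y and N expresses y through x. *)
Lemma nielsen_zero h (y : 'I_h -> A) :
    (h < n)%N -> (exists x, P x) ->
    (forall v, exists c, v = lincomb y c) ->
    (forall x v, P x -> exists c, v = lincomb x c) ->
  exists x i, P x /\ x i = 0.
Proof.
move=> hn exP yspan xspan.
have [x [i [d [Px xd dc]]]] := reduced_tuple (leq_ltn_trans (leq0n h) hn) exP.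
exists x, i; split=> //.
have [m mE] := choice (fun i => yspan (x i)).
have [l lE] := choice (fun j => xspan x (y j) Px).
suff d1 : `|d|%N = 1%N.
  have [dE|dE] : d = 1 \/ d = - 1 by case: (intP d) d1 => //= k [->]; auto.
    by move: xd; rewrite dE.
  by apply/eqP; rewrite -oppr_eq0 -[x i]mulr1z -mulrNz -dE xd.
pose M := \matrix_(i, j) m i j; pose N := \matrix_(j, i) l j i.
apply: (@factor_identity_mod n h M N) => // a b.
apply: (dc (fun b => (M *m N - 1%:M) a b)).
rewrite /lincomb; under eq_bigr do rewrite !mxE mulrzBr.
rewrite sumrB; apply/eqP; rewrite subr_eq0; apply/eqP.
rewrite [RHS](bigD1 a) //= eqxx [X in _ + X]big1 ?addr0 => [|j /negPf ja]; last first.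
  by rewrite eq_sym ja.
rewrite [RHS]mE /lincomb.
under eq_bigr do rewrite mulrz_sumr.
rewrite exchange_big /=; apply: eq_bigr => j _.
rewrite [in RHS]lE /lincomb mulrz_suml; apply: eq_bigr => k _.
by rewrite !mxE mulrC mulrzA.
Qed.

End Reduction.
End Tuples.

Section Lincomb.
Variables (A : zmodType) (n : nat) (x : 'I_n -> A).

Lemma lincomb0 : lincomb x (fun=> 0) = 0.
Proof. by rewrite /lincomb big1. Qed.

Lemma lincombD c d : lincomb x (fun i => c i + d i) = lincomb x c + lincomb x d.
Proof. by rewrite -big_split; apply: eq_bigr => i _; rewrite mulrzDr. Qed.

Lemma lincombN c : lincomb x (fun i => - c i) = - lincomb x c.
Proof. by rewrite -sumrN; apply: eq_bigr => i _; rewrite mulrNz. Qed.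

Lemma lincomb_delta i : lincomb x (fun j => (j == i)%:Z) = x i.
Proof.
rewrite /lincomb (bigD1 i) //= eqxx big1 ?addr0 // => j /negPf ->.
by rewrite mulr0z.
Qed.

End Lincomb.

(** * Commutative groups in additive notation *)

(** A copy of a commutative group carrying the zmodule structure, so that integral
combinations and their big sums are available for it. *)
Definition additive (V : groupType) (Vc : forall x y : V, commute x y) : Type := V.

Section Additive.
Variables (V : groupType) (Vc : forall x y : V, commute x y).
HB.instance Definition _ := Choice.on (additive Vc).
Fact additive_addA : associative (fun x y : additive Vc => (x : V) * y : additive Vc)%g.
Proof. exact: mulgA. Qed.
Fact additive_addC : commutative (fun x y : additive Vc => (x : V) * y : additive Vc)%g.
Proof. exact: Vc. Qed.
Fact additive_add0 :
  left_id (1%g : V) (fun x y : additive Vc => (x : V) * y : additive Vc)%g.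
Proof. exact: mul1g. Qed.
Fact additive_addN : left_inverse (1%g : V) (fun x : additive Vc => (x : V)^-1 : additive Vc)%g
  (fun x y : additive Vc => (x : V) * y : additive Vc)%g.
Proof. exact: mulVg. Qed.
HB.instance Definition _ := GRing.isZmodule.Build (additive Vc)
  additive_addA additive_addC additive_add0 additive_addN.
End Additive.

(** * Morphisms, normal closures and quotients *)

Section Morphic.
Local Open Scope classical_set_scope.
Local Open Scope group_scope.
Implicit Types G H K L V : groupType.

(* Isomorphisms are only asked to be multiplicative; between groups this makes
   them respect the unit and the inverse as well. *)
Section Morphisms.
Variables (G H : groupType) (f : {multiplicative G -> H}).

Lemma mult1 : f 1 = 1.
Proof. by apply: (mulgI (f 1)); rewrite -gmulfM !mulg1. Qed.

Lemma multV x : f x^-1 = (f x)^-1.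
Proof. by apply: (mulgI (f x)); rewrite -gmulfM !mulgV mult1. Qed.

Lemma multJ x y : f (x ^ y) = f x ^ f y.
Proof. by rewrite !conjgE !gmulfM multV. Qed.

Lemma multR x y : f [~ x, y] = [~ f x, f y].
Proof. by rewrite !commgEl gmulfM multV multJ. Qed.

End Morphisms.

Definition surjective G H (f : G -> H) := forall y, exists x, f x = y.

Lemma surjective_comp G H K (g : H -> K) (f : G -> H) :
  surjective g -> surjective f -> surjective (g \o f).
Proof. by move=> gS fS z; have [y <-] := gS z; have [x <-] := fS y; exists x. Qed.

Lemma surjective_proj G (N : normal_subgroup G) : surjective (quotient_proj N).
Proof. by move=> X; exists (repr X); rewrite /quotient_proj reprK. Qed.

Lemma quotient_proj_eq1 G (N : normal_subgroup G) x :
  quotient_proj N x = 1 <-> normal_carrier N x.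
Proof.
have [[_ _ NV] _] := Defs.normalP N.
split=> [/esym /quotient_projP|Nx].
  by rewrite invg1 mul1g.
by apply/esym/quotient_projP; rewrite invg1 mul1g.
Qed.

Lemma normal1 G (N : normal_subgroup G) : normal_carrier N 1.
Proof. by have [[]] := Defs.normalP N. Qed.

Lemma sub_normal_closure G (A : set G) : A `<=` normal_closure A.
Proof. exact: sub_gen_smallest. Qed.

Lemma normal_closure_min G (A : set G) (N : normal_subgroup G) :
  A `<=` N -> normal_closure A `<=` N.
Proof. by move=> AN; apply: smallest_sub => //; exact: Defs.normalP. Qed.

Lemma commutator_min G (N : set G) :
  is_subgroup N -> (forall x y, N [~ x, y]) -> commutator_subgroup G `<=` N.
Proof. by move=> sN cN; apply: smallest_sub => // _ [x [y ->]]. Qed.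

Lemma mem_commutator G (x y : G) : normal_carrier (commutator_subgroup G) [~ x, y].
Proof. by apply: sub_gen_smallest; exists x, y. Qed.

Lemma preimage_normal G H (f : {multiplicative G -> H}) (N : normal_subgroup H) :
  is_normal (f @^-1` N).
Proof.
have [[N1 NM NV] NJ] := Defs.normalP N; split; first split=> [|x y|x] /=.
- by rewrite mult1.
- by rewrite gmulfM; exact: NM.
- by rewrite multV; exact: NV.
by move=> x g /=; rewrite multJ; exact: NJ.
Qed.

Lemma image_normal G H (f : {multiplicative G -> H}) (N : normal_subgroup G) :
  surjective f -> is_normal (f @` N).
Proof.
move=> fS; have [[N1 NM NV] NJ] := Defs.normalP N; split; first split.
- by exists 1; rewrite ?mult1.
- by move=> _ _ [x Nx <-] [y Ny <-]; exists (x * y); [exact: NM|rewrite gmulfM].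
- by move=> _ [x Nx <-]; exists x^-1; [exact: NV|rewrite multV].
move=> _ g [x Nx <-]; have [z <-] := fS g.
by exists (x ^ z); [exact: NJ|rewrite multJ].
Qed.

Lemma normal_closure_preimage G H (f : {multiplicative G -> H}) (A : set G)
    (N : normal_subgroup H) x :
  (forall a, A a -> normal_carrier N (f a)) ->
  normal_carrier (normal_closure A) x -> normal_carrier N (f x).
Proof.
by move=> AN; apply: (@normal_closure_min _ _ (NormalSubgroup (preimage_normal f N))).
Qed.

Lemma normal_closure_image G H (f : {multiplicative G -> H}) (A : set G) :
  surjective f -> normal_closure (f @` A) `<=` f @` normal_closure A.
Proof.
move=> fS; have fN := image_normal (normal_closure A) fS.
apply: (@normal_closure_min _ _ (NormalSubgroup fN)).
by move=> _ [a Aa <-]; exists a => //; exact: sub_normal_closure.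
Qed.

Lemma commutator_image_sub G H (f : {multiplicative G -> H}) x :
  normal_carrier (commutator_subgroup G) x ->
  normal_carrier (commutator_subgroup H) (f x).
Proof.
have [sN _] := preimage_normal f (commutator_subgroup H).
apply: (commutator_min sN) => y z /=.
by rewrite multR; exact: mem_commutator.
Qed.

Lemma commutator_image G H (f : {multiplicative G -> H}) :
  surjective f -> commutator_subgroup H `<=` f @` commutator_subgroup G.
Proof.
move=> fS; have [sN _] := image_normal (commutator_subgroup G) fS.
apply: (commutator_min sN) => y z.
have [a <-] := fS y; have [b <-] := fS z.
by exists [~ a, b]; [exact: mem_commutator|rewrite multR].
Qed.

Lemma factor_through G H L (f : {multiplicative G -> H})
    (g : {multiplicative G -> L}) :
  surjective f -> (forall x, f x = 1 -> g x = 1) ->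
  exists k : {multiplicative H -> L}, forall x, k (f x) = g x.
Proof.
move=> fS fg; have [s sK] := choice fS.
have gE x y : f x = f y -> g x = g y.
  move=> fxy; apply/divg1_eq; rewrite -multV -gmulfM fg //.
  by rewrite gmulfM multV fxy mulgV.
have kM : {morph (g \o s) : x y / x * y}.
  by move=> x y /=; rewrite -gmulfM; apply: gE; rewrite gmulfM !sK.
pose mk := isMultiplicative.Build H L (g \o s) kM.
pose k : {multiplicative H -> L} := HB.pack (g \o s) mk.
by exists k => x; apply: gE; rewrite sK.
Qed.

Lemma mult_inj G H (f : {multiplicative G -> H}) :
  (forall x, f x = 1 -> x = 1) -> injective f.
Proof.
move=> f1 x y fxy; apply/divg1_eq/f1.
by rewrite gmulfM multV fxy mulgV.
Qed.

Lemma bijective_of G H (f : {multiplicative G -> H}) :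
  surjective f -> (forall x, f x = 1 -> x = 1) -> bijective f.
Proof.
move=> fS /mult_inj fI; have [s sK] := choice fS.
by exists s => // x; apply: fI; rewrite sK.
Qed.

Lemma bijective_surjective G H (f : G -> H) : bijective f -> surjective f.
Proof. by case=> g _ gK y; exists (g y). Qed.

Lemma isomorphic_refl G : isomorphic G G.
Proof. by exists idfun; exists idfun. Qed.

Lemma isomorphic_sym G H : isomorphic G H -> isomorphic H G.
Proof.
case=> f [g fK gK].
pose mg := isMultiplicative.Build H G g (can2_gmulfM fK gK).
pose G' : {multiplicative H -> G} := HB.pack g mg.
by exists G'; exists f.
Qed.

Lemma isomorphic_trans G H K : isomorphic G H -> isomorphic H K -> isomorphic G K.
Proof. by move=> [f fB] [g gB]; exists (g \o f); exact: bij_comp. Qed.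

Definition quotient_map G H (f : G -> H) (N : set G) :=
  surjective f /\ forall x, f x = 1 <-> N x.

Lemma quotient_map_proj G (N : normal_subgroup G) :
  quotient_map (quotient_proj N) N.
Proof. by split=> [|x]; [exact: surjective_proj|exact: quotient_proj_eq1]. Qed.

Lemma quotient_map_iso G H K (f : {multiplicative G -> H}) (N : set G)
    (i : {multiplicative H -> K}) :
  quotient_map f N -> bijective i -> quotient_map (i \o f) N.
Proof.
move=> [fS fN] iB; split=> [|x].
  by apply: surjective_comp => //; exact: bijective_surjective.
rewrite -fN /=; split=> [|->]; last by rewrite mult1.
by move=> ifx; apply: (bij_inj iB); rewrite ifx mult1.
Qed.

Definition is_quotient_by G H (f : G -> H) (A : set G) :=
  quotient_map f (normal_closure A).

Definition abelianizes G V (f : G -> V) :=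
  quotient_map f (commutator_subgroup G).

Lemma isomorphic_quotientP G H (A : set G) :
  isomorphic H (quotient_group (normal_closure A)) <->
  exists f : {multiplicative G -> H}, is_quotient_by f A.
Proof.
split=> [/isomorphic_sym[i iB]|[f [fS fA]]].
  by exists (i \o quotient_proj (normal_closure A));
    apply: quotient_map_iso => //; exact: quotient_map_proj.
have [pS pA] := quotient_map_proj (normal_closure A).
have [k kE] : exists k : {multiplicative H -> quotient_group (normal_closure A)},
    forall x, k (f x) = quotient_proj (normal_closure A) x.
  by apply: factor_through => // x /fA /pA.
exists k; apply: bijective_of => [y|y].
  by have [x <-] := pS y; exists (f x).
by have [x <-] := fS y; rewrite kE => /pA /fA.
Qed.

(** Imposing the relators of A and B together amounts to imposing those of A
first, then the images of those of B. *)
Lemma quotient_by_factor G H K (f : {multiplicative G -> H})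
    (g : {multiplicative G -> K}) (A B : set G) :
  is_quotient_by f A -> is_quotient_by g (A `|` B) ->
  exists2 k : {multiplicative H -> K},
    is_quotient_by k (f @` B) & forall x, k (f x) = g x.
Proof.
move=> [fS fA] [gS gAB].
have [k kE] : exists k : {multiplicative H -> K}, forall x, k (f x) = g x.
  apply: factor_through => // x /fA Ax; apply/gAB.
  by apply: normal_closure_min Ax => y Ay; apply: sub_normal_closure; left.
exists k => //; split=> [z|y]; first by have [x <-] := gS z; exists (f x).
have [x <-] := fS y; rewrite kE; split=> [/gAB|].
  apply: normal_closure_preimage.
  move=> z [Az|Bz] /=; last by apply: sub_normal_closure; exists z.
  have -> : f z = 1 by apply/fA; exact: sub_normal_closure.
  exact: (@normal1 _ (normal_closure (f @` B))).
move=> /(normal_closure_image fS)[z Bz] fzx; rewrite -kE -fzx kE.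
by apply/gAB; apply: normal_closure_min Bz => t Bt; apply: sub_normal_closure; right.
Qed.

Lemma quotient_by_comp G H K (f : {multiplicative G -> H})
    (k : {multiplicative H -> K}) (A B : set G) :
  is_quotient_by f A -> is_quotient_by k (f @` B) ->
  is_quotient_by (k \o f) (A `|` B).
Proof.
move=> [fS fA] [kS kB]; split=> [|x /=]; first exact: surjective_comp.
have [[_ NM _] _] := Defs.normalP (normal_closure (A `|` B)).
split=> [/kB /(normal_closure_image fS)[z Bz fzx]|].
  rewrite -[x](mulVKg z); apply: NM.
    by apply: normal_closure_min Bz => t Bt; apply: sub_normal_closure; right.
  have : f (z^-1 * x) = 1 by rewrite gmulfM multV fzx mulVg.
  by move=> /fA; apply: normal_closure_min => t At; apply: sub_normal_closure; left.
rewrite kB.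
apply: normal_closure_preimage.
move=> z [Az|Bz] /=; last by apply: sub_normal_closure; exists z.
have -> : f z = 1 by apply/fA; exact: sub_normal_closure.
exact: (@normal1 _ (normal_closure (f @` B))).
Qed.

Lemma kernel_normal G H (f : {multiplicative G -> H}) : is_normal [set x | f x = 1].
Proof.
split; first split=> [|x y|x] /=.
- exact: mult1.
- by rewrite gmulfM => -> ->; rewrite mulg1.
- by rewrite multV => ->; rewrite invg1.
by move=> x g /=; rewrite multJ => ->; rewrite conj1g.
Qed.

Lemma normal_closure_kernel G H (f : {multiplicative G -> H}) (A : set G) x :
  (forall a, A a -> f a = 1) -> normal_carrier (normal_closure A) x -> f x = 1.
Proof.
by move=> fA; apply: (@normal_closure_min _ _ (NormalSubgroup (kernel_normal f))).
Qed.

End Morphic.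

(** * Replacements as pairs of quotients *)

Section Replacements.
Local Open Scope classical_set_scope.
Local Open Scope group_scope.
Implicit Types G H K L V : groupType.

(** Commutator subgroups are preserved by morphisms, so the condition may be
tested in any quotient map presenting the group. *)
Lemma null_homologousP (S : choiceType) (R : set (free_group S)) G
    (f : {multiplicative free_group S -> G}) w :
  is_quotient_by f R ->
  null_homologous R w <-> normal_carrier (commutator_subgroup G) (f w).
Proof.
move=> [fS fR]; have [pS pR] := quotient_map_proj (normal_closure R).
split=> [Dw|Dw].
  have [k kE] : exists k : {multiplicative presented_group R -> G},
      forall x, k (quotient_proj (normal_closure R) x) = f x.
    by apply: factor_through => // x /pR /fR.
  by rewrite -kE; exact: commutator_image_sub.
have [k kE] : exists k : {multiplicative G -> presented_group R},
    forall x, k (f x) = quotient_proj (normal_closure R) x.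
  by apply: factor_through => // x /fR /pR.
by rewrite /null_homologous -kE; exact: commutator_image_sub.
Qed.

(** The presentation-free form of a null-homologous replacement: K stands for the
group of the common relators, u and v for the two exchanged relators. *)
Definition linked G G' :=
  exists (K : groupType) (p : {multiplicative K -> G})
         (q : {multiplicative K -> G'}) (u v : K),
  [/\ is_quotient_by p [set u], is_quotient_by q [set v],
      normal_carrier (commutator_subgroup G) (p v) &
      normal_carrier (commutator_subgroup G') (q u)].

Lemma linked_sym G G' : linked G G' -> linked G' G.
Proof. by case=> K [p] [q] [u] [v] [? ? ? ?]; exists K, q, p, v, u. Qed.

Lemma linked_of_replacement G G' : null_homologous_replacement G G' -> linked G G'.
Proof.
case=> S [R] [r] [r'] [Rr /isomorphic_quotientP[f fR] /isomorphic_quotientP[g gR]].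
move=> /(null_homologousP _ gR) Dr /(null_homologousP _ fR) Dr'.
(* K is the group presented by R minus r, which R and R' both contain. *)
have {}fR : is_quotient_by f ((R `\ r) `|` [set r]) by rewrite setUC setDUK // => _ ->.
have [p pQ pE] := quotient_by_factor (quotient_map_proj (normal_closure _)) fR.
have [q qQ qE] := quotient_by_factor (quotient_map_proj (normal_closure _)) gR.
rewrite !image_set1 in pQ qQ.
exists (quotient_group (normal_closure (R `\ r))), p, q.
exists (quotient_proj _ r), (quotient_proj _ r').
by split=> //; rewrite ?pE ?qE.
Qed.

(** Take all elements of K as generators and all relations of K as relators. *)
Lemma replacement_of_linked G G' : linked G G' -> null_homologous_replacement G G'.
Proof.
case=> K [p] [q] [u] [v] [pQ qQ Dv Du].
have [ev evE] := free_group_lift (fun k : K => k).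
have evS : surjective ev by move=> k; exists (free_gen k).
pose R0 : set (free_group K) := [set w | ev w = 1].
(* The relator for u must be removable without losing a relation of K: the word
   for u is not itself a relation of K unless u = 1, and then the empty word is
   used, which imposes nothing. *)
pose r : free_group K := if u == 1 then 1 else free_gen u.
have evr : ev r = u.
  by rewrite /r; case: eqP => [->|_]; [exact: mult1|exact: evE].
have evQ : is_quotient_by ev (R0 `\ r).
  split=> // w; split=> [evw|]; last first.
    by apply: (@normal_closure_min _ _ (NormalSubgroup (kernel_normal ev))) => x [].
  case: (w =P r) => [wr|wr]; last by apply: sub_normal_closure; split.
  by move: evw; rewrite wr evr => u1; rewrite /r u1 eqxx; exact: normal1.
have RD : ((R0 `|` [set r]) `\ r) = R0 `\ r.
  by rewrite setDUl setDv setU0.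
have RU : R0 `|` [set r] = (R0 `\ r) `|` [set r].
  by rewrite setUDl setDv setD0.
have fQ : is_quotient_by (p \o ev) (R0 `|` [set r]).
  by rewrite RU; apply: quotient_by_comp => //; rewrite image_set1 evr.
have gQ : is_quotient_by (q \o ev) ((R0 `|` [set r]) `\ r `|` [set free_gen v]).
  by rewrite RD; apply: quotient_by_comp => //; rewrite image_set1 evE.
exists K, (R0 `|` [set r]), r, (free_gen v); split.
- by right.
- by apply/isomorphic_quotientP; exists (p \o ev).
- by apply/isomorphic_quotientP; exists (q \o ev).
- by apply/(null_homologousP _ gQ) => /=; rewrite evr.
- by apply/(null_homologousP _ fQ) => /=; rewrite evE.
Qed.

Lemma linked_iso G G1 G2 : isomorphic G G1 -> linked G1 G2 -> linked G G2.
Proof.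
move=> /isomorphic_sym[i iB] [K] [p] [q] [u] [v] [pQ qQ Dv Du].
exists K, (i \o p), q, u, v; split=> //; first exact: quotient_map_iso.
exact: (commutator_image_sub i Dv).
Qed.

Lemma replacement_sym G G' :
  null_homologous_replacement G G' -> null_homologous_replacement G' G.
Proof. by move=> /linked_of_replacement/linked_sym/replacement_of_linked. Qed.

Lemma converts_in_iso n G G1 G2 :
  isomorphic G G1 -> converts_in n G1 G2 -> converts_in n G G2.
Proof.
case: n => [|n] /= iG; first exact: isomorphic_trans.
case=> G3 /linked_of_replacement r13 c32; exists G3 => //.
by apply: replacement_of_linked; exact: linked_iso r13.
Qed.

Lemma converts_in_trans n m G G1 G2 :
  converts_in n G G1 -> converts_in m G1 G2 -> converts_in (n + m) G G2.
Proof.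
elim: n G => [|n IH] G /=; first exact: converts_in_iso.
by case=> G3 r c c'; exists G3 => //; exact: IH c'.
Qed.

Lemma converts_in_sym n G G1 : converts_in n G G1 -> converts_in n G1 G.
Proof.
elim: n G => [|n IH] G /=; first exact: isomorphic_sym.
case=> G3 r c; rewrite -/(converts_in n.+1 G1 G) -addn1.
apply: converts_in_trans (IH _ c) _.
by exists G; [exact: replacement_sym|exact: isomorphic_refl].
Qed.

End Replacements.

(** * The Ma-Qiu index along replacements *)

Section MaQiu.
Local Open Scope classical_set_scope.
Local Open Scope group_scope.
Implicit Types G H K L V : groupType.

Definition commutator_normally_generated_by G (s : seq G) :=
  [set` s] `<=` commutator_subgroup G /\
  commutator_subgroup G `<=` normal_closure [set` s].

(** Lift the given elements to D(K): with u they normally generate a subgroup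
containing D(K), since G is the quotient of K by u alone.  Then push everything
forward to G', where u falls into the commutator subgroup. *)
Lemma MaQiu_linked G G' s : linked G G' ->
  commutator_normally_generated_by (s : seq G) ->
  exists2 s' : seq G', size s' = (size s).+1 & commutator_normally_generated_by s'.
Proof.
case=> K [p] [q] [u] [v] [[pS pu] [qS qv] Dv Du] [sD Ds].
have /choice[l lP] : forall x : G, exists y : K,
    normal_carrier (commutator_subgroup G) x ->
    p y = x /\ normal_carrier (commutator_subgroup K) y.
  move=> x; have [/(commutator_image pS)[y Dy yx]|] :=
    pselect (normal_carrier (commutator_subgroup G) x); first by exists y.
  by move=> nx; exists 1.
exists (q u :: map (q \o l) s); first by rewrite /= size_map.
split=> [y|y /(commutator_image qS)[x Dx <-]].
  rewrite /= inE => /orP[/eqP->//|/mapP[x xs ->]].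
  by apply: commutator_image_sub; have [] := lP _ (sD x xs).
have [[N1 NM NV] _] := Defs.normalP (normal_closure [set` u :: map l s]).
suff : normal_carrier (normal_closure [set` u :: map l s]) x.
  apply: normal_closure_preimage => z zs.
  apply: sub_normal_closure; move: zs; rewrite /= !inE map_comp.
  by case/orP => [/eqP->|zs]; rewrite ?eqxx // map_f ?orbT.
have ps : p @` [set` map l s] = [set` s].
  apply/seteqP; split=> [_ [_ /mapP[z zs ->] <-]|z zs] /=.
    by have [->] := lP _ (sD z zs).
  by exists (l z); [exact: map_f|have [->] := lP _ (sD z zs)].
have /Ds := commutator_image_sub p Dx.
rewrite -ps => /(normal_closure_image pS)[z zs pzx].
rewrite -[x](mulVKg z); apply: NM.
  by apply: normal_closure_min zs => t ts; apply: sub_normal_closure; rewrite /= inE ts orbT.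
have /pu : p (z^-1 * x) = 1 by rewrite gmulfM multV pzx mulVg.
by apply: normal_closure_min => _ ->; apply: sub_normal_closure; rewrite /= inE eqxx.
Qed.

Lemma MaQiu_image G G' (f : {multiplicative G -> G'}) s : surjective f ->
  commutator_normally_generated_by (s : seq G) ->
  commutator_normally_generated_by (map f s).
Proof.
move=> fS [sD Ds]; split=> [y /mapP[x xs ->]|y /(commutator_image fS)[x Dx <-]].
  by apply: commutator_image_sub; exact: sD.
have := Ds _ Dx; apply: normal_closure_preimage => z zs.
by apply: sub_normal_closure; exact: map_f.
Qed.

Lemma MaQiu_converts n G G' s : converts_in n G G' ->
  commutator_normally_generated_by (s : seq G) ->
  exists2 s' : seq G', size s' = (size s + n)%N & commutator_normally_generated_by s'.
Proof.
elim: n G s => [|n IH] G s /=.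
  case=> f /bijective_surjective fS /(MaQiu_image fS) sP.
  by exists (map f s) => //; rewrite size_map addn0.
case=> G1 /linked_of_replacement l c /(MaQiu_linked l)[s1 s1E /(IH _ _ c)[s' s'E s'P]].
by exists s' => //; rewrite s'E s1E addSnnS.
Qed.

(** Killing a in D(G) replaces the trivial relator by a, with G itself as the
common group.  The quotient has the same abelianization V, and the images of the
remaining elements normally generate its commutator subgroup. *)
Lemma converts_in_abelianization G V (f : {multiplicative G -> V}) s :
  abelianizes f -> commutator_normally_generated_by (s : seq G) ->
  converts_in (size s) G V.
Proof.
move sn: (size s) => n; elim: n G f s sn => [|n IH] G f [|a s] //= => [_|[sn]];
  move=> [fS fD] [sD Ds].
  exists f; apply: bijective_of => // x /fD/Ds.
  by apply: (normal_closure_kernel (f := idfun)).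
pose q := quotient_proj (normal_closure [set a]).
have [qS qa] := quotient_map_proj (normal_closure [set a]).
have Da : normal_carrier (commutator_subgroup G) a.
  by apply: sD; rewrite /= inE eqxx.
have [k kE] : exists k : {multiplicative quotient_group (normal_closure [set a]) -> V},
    forall x, k (q x) = f x.
  apply: factor_through => // x /qa; apply: normal_closure_kernel => _ ->.
  exact/fD.
exists (quotient_group (normal_closure [set a])).
  apply: replacement_of_linked.
  exists G, idfun, q, 1, a; split=> //.
  - split=> [x|x]; first by exists x.
    rewrite /=; split=> [->|]; first exact: sub_normal_closure.
    by apply: (normal_closure_kernel (f := idfun)).
  - by rewrite mult1; exact: normal1.
apply: (IH _ k (map q s)); first by rewrite size_map.
  split=> [y|y]; first by have [x <-] := fS y; exists (q x).
  have [x <-] := qS y; rewrite -/q kE; split=> [/fD|]; first exact: commutator_image_sub.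
  by move=> /(commutator_image qS)[z /fD fz qzx]; rewrite -kE -qzx kE.
have [] : commutator_normally_generated_by (map q (a :: s)) by apply: MaQiu_image.
move=> qD Dq; split=> [y ys|y /Dq].
  by apply: qD; rewrite /= inE ys orbT.
apply: normal_closure_min => {}y; rewrite /= inE => /orP[/eqP->|ys]; last first.
  exact: sub_normal_closure.
have -> : q a = 1 by apply/qa; exact: sub_normal_closure.
exact: (@normal1 _ (normal_closure [set` map q s])).
Qed.

End MaQiu.

(** * Generating sets adapted to the abelianization *)

Section Generation.
Local Open Scope classical_set_scope.
Local Open Scope group_scope.
Implicit Types G H K L V : groupType.

Definition generates G (s : seq G) := generated_subgroup [set` s] = setT.

Lemma generated_is_subgroup G (A : set G) : is_subgroup (generated_subgroup A).
Proof. exact: subgroup_smallest. Qed.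

Lemma generated_min G (A N : set G) :
  is_subgroup N -> A `<=` N -> generated_subgroup A `<=` N.
Proof. exact: smallest_sub. Qed.

Lemma generatesP G s : generates (s : seq G) <->
  forall N : set G, is_subgroup N -> (forall x, x \in s -> N x) -> forall x, N x.
Proof.
split=> [sG N sN sub x|sG].
  have : generated_subgroup [set` s] x by rewrite sG.
  by apply: generated_min.
apply/seteqP; split=> // x _; apply: sG; first exact: generated_is_subgroup.
by move=> y ys; apply: sub_gen_smallest.
Qed.

Lemma generates_commuting G s : generates (s : seq G) ->
  {in s &, forall x y, commute x y} -> forall x y : G, commute x y.
Proof.
move=> /generatesP sG sc.
have cent (x : G) : is_subgroup [set y | commute x y].
  split=> [|y z|y] /=; [exact: commute1|exact: commuteM|exact: commuteV].
have sx x : x \in s -> forall y, commute x y.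
  by move=> xs; apply: (sG _ (cent x)) => y ys; exact: sc.
by move=> x y; apply: (sG _ (cent x)) => z zs; apply: commute_sym; exact: sx.
Qed.

Lemma generates_image G H (f : {multiplicative G -> H}) s :
  surjective f -> generates s -> generates (map f s).
Proof.
move=> fS /generatesP sG; apply/generatesP => N [N1 NM NV] sN y.
have [x <-] := fS y.
apply: (sG (f @^-1` N)) => [|z zs]; last by apply: sN; exact: map_f.
split=> [|a b|a] /=; first by rewrite mult1.
  by rewrite gmulfM; exact: NM.
by rewrite multV; exact: NV.
Qed.

Fixpoint commutator_pairs G (s : seq G) : seq G :=
  if s is x :: s' then [seq [~ x, y] | y <- s'] ++ commutator_pairs s' else [::].

Lemma size_commutator_pairs G (s : seq G) :
  size (commutator_pairs s) = 'C(size s, 2).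
Proof. by elim: s => //= x s IH; rewrite size_cat size_map IH binS bin1 addnC. Qed.

Lemma commutator_pairs_kernel G H (f : {multiplicative G -> H}) (s : seq G) :
  (forall z, z \in commutator_pairs s -> f z = 1) ->
  {in s &, forall x y, commute (f x) (f y)}.
Proof.
elim: s => // a s IH fs.
have {}IH : {in s &, forall x y, commute (f x) (f y)}.
  by apply: IH => z zs; apply: fs; rewrite /= mem_cat zs orbT.
have fa y : y \in s -> commute (f a) (f y).
  move=> ys; apply/commgP; rewrite -multR; apply/eqP/fs.
  by rewrite /= mem_cat map_f.
move=> x y; rewrite !inE => /orP[/eqP->|xs] /orP[/eqP->|ys].
- exact: commute_refl.
- exact: fa.
- exact/commute_sym/fa.
- exact: IH.
Qed.

Lemma commutator_pairs_sub G (s : seq G) z :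
  z \in commutator_pairs s -> normal_carrier (commutator_subgroup G) z.
Proof.
elim: s => //= x s IH; rewrite mem_cat => /orP[/mapP[y _ ->]|/IH//].
exact: mem_commutator.
Qed.

(** In the quotient by these elements the generators commute, so the quotient is
commutative. *)
Lemma MaQiu_of_generators G (s t : seq G) :
    generates (s ++ t) ->
    (forall x, x \in t -> normal_carrier (commutator_subgroup G) x) ->
  commutator_normally_generated_by (t ++ commutator_pairs s).
Proof.
move=> sG tD; split=> [x|].
  by rewrite /= mem_cat => /orP[/tD//|/commutator_pairs_sub].
set N := normal_closure _.
have NE z : z \in t ++ commutator_pairs s -> quotient_proj N z = 1.
  by move=> zs; apply/quotient_proj_eq1; exact: sub_normal_closure.
have [sN _] := Defs.normalP N.
apply: (commutator_min sN) => x y; apply/quotient_proj_eq1.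
rewrite multR; apply/eqP/commgP.
have := generates_commuting (generates_image (@surjective_proj _ N) sG).
apply; move: x y => _ _.
have t1 z : z \in t -> quotient_proj N z = 1.
  by move=> zt; apply: NE; rewrite mem_cat zt.
move=> _ _ /mapP[a + ->] /mapP[b + ->]; rewrite !mem_cat.
move=> /= /orP[sa|/t1->] /orP[sb|/t1->].
- apply: (@commutator_pairs_kernel _ _ (quotient_proj N) s) => // z zs.
  by apply: NE; rewrite mem_cat zs orbT.
- exact: commute1.
- exact/commute_sym/commute1.
- exact: commute1.
Qed.

End Generation.

Section Nielsen.
Local Open Scope classical_set_scope.
Implicit Types G H K L V : groupType.

Lemma generates_lincomb V (Vc : forall x y : V, commute x y) (s : seq V)
    (y : 'I_(size s) -> additive Vc) :
  (forall i, y i = tnth (in_tuple s) i) -> generates s ->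
  forall v : additive Vc, exists c, v = lincomb y c.
Proof.
move=> yE /generatesP; apply.
  split=> [|a b [c ->] [d ->]|a [c ->]].
  - by exists (fun=> 0); rewrite lincomb0.
  - by exists (fun i => c i + d i); rewrite lincombD.
  - by exists (fun i => - c i); rewrite lincombN.
move=> z /(tnthP (in_tuple s))[i ->]; rewrite -yE.
by exists (fun j => (j == i)%:Z); rewrite lincomb_delta.
Qed.

Lemma abelianizes_commute G V (f : {multiplicative G -> V}) :
  abelianizes f -> forall x y : V, commute x y.
Proof.
move=> [fS fD] x y; have [a <-] := fS x; have [b <-] := fS y.
by apply/commgP/eqP; rewrite -multR; apply/fD; exact: mem_commutator.
Qed.

Lemma eq_generates G (s t : seq G) : s =i t -> generates s -> generates t.
Proof.
move=> st /generatesP sG; apply/generatesP => N sN tN; apply: sG => // x.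
by rewrite st; exact: tN.
Qed.

(** Integral combinations of elements of V lift through f to a given subgroup as
soon as their terms do. *)
Lemma lift_sum G V (Vc : forall x y : V, commute x y) (f : {multiplicative G -> V})
    (N : set G) n (Q : pred 'I_n) (x : 'I_n -> additive Vc) (k : 'I_n -> int) :
  is_subgroup N -> (forall j, Q j -> exists2 g, N g & f g = x j) ->
  exists2 g, N g & (f g : additive Vc) = \sum_(j | Q j) x j *~ k j.
Proof.
move=> [N1 NM NV] Nx; pose S (v : additive Vc) := exists2 g, N g & f g = v.
have S0 : S 0 by exists 1%g; rewrite ?mult1.
have SD v w : S v -> S w -> S (v + w).
  by move=> [a Na <-] [b Nb <-]; exists (a * b)%g; [exact: NM|rewrite gmulfM].
have SN v : S v -> S (- v).
  by move=> [a Na <-]; exists (a^-1)%g; [exact: NV|rewrite multV].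
have SMn v m : S v -> S (v *+ m).
  by move=> Sv; elim: m => [//|m IH]; rewrite mulrS; exact: SD.
apply: (big_ind S) => // j /Nx Sx.
case: (k j) => m; first exact: SMn.
by rewrite NegzE mulrNz; apply: SN; exact: SMn.
Qed.

(** [nielsen_zero] for the images in V of the generating tuples of G: a move on
images lifts to one on generators, because x_i is changed by the image of an
element w of the subgroup generated by the other g_j, and g_i w generates with
them the same subgroup as g_i.  The elements of t are invisible in V and only
carried along. *)
Lemma kill_generator G V (f : {multiplicative G -> V}) (y : seq V) (s t : seq G) :
    abelianizes f -> generates y -> (size y < size s)%N ->
    generates (s ++ t) ->
    (forall x, x \in t -> normal_carrier (commutator_subgroup G) x) ->
  exists s' t', [/\ (size s').+1 = size s, size t' = (size t).+1,
    generates (s' ++ t') &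
    forall x, x \in t' -> normal_carrier (commutator_subgroup G) x].
Proof.
move=> fA yV lt_ys stG tD; have Vc := abelianizes_commute fA.
have [fS fD] := fA.
pose P (x : 'I_(size s) -> additive Vc) := exists2 g : 'I_(size s) -> G,
  generates (codom g ++ t) & forall i, f (g i) = x i.
have Pmove x i k : P x -> P (nielsen_move x i k).
  move=> [g gG gx].
  have [w Nw fw] := lift_sum (Q := fun j => j != i) k
    (generated_is_subgroup [set z | exists2 j, j != i & z = g j])
    (fun j ji => ex_intro2 _ _ (g j) (sub_gen_smallest (ex_intro2 _ _ j ji erefl)) (gx j)).
  exists (fun l => if l == i then g i * w else g l)%g; last first.
    by move=> l; rewrite /nielsen_move; case: eqP => // _; rewrite gmulfM gx fw.
  apply/generatesP => N sN gN; have [N1 NM NV] := sN.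
  have Ng j : j != i -> N (g j).
    move=> ji; apply: gN; rewrite mem_cat; apply/orP; left.
    by apply/codomP; exists j; rewrite (negPf ji).
  have Nw' : N w by apply: generated_min Nw => // _ [j ji ->]; exact: Ng.
  move/generatesP: gG; apply=> // z; rewrite mem_cat => /orP[/codomP[j ->]|zt].
    have [->|/Ng//] := eqVneq j i.
    rewrite -[g i](mulgK w); apply: NM; last exact: NV.
    by apply: gN; rewrite mem_cat; apply/orP; left; apply/codomP; exists i; rewrite eqxx.
  by apply: gN; rewrite mem_cat zt orbT.
have Pspan x v : P x -> exists c, v = lincomb x c.
  move=> [g /generatesP gG gx]; have [a <-] := fS v; move: a.
  apply: gG => [|z].
    split=> [|a b [c ac] [d bd]|a [c ac]].
    - by exists (fun=> 0); rewrite lincomb0 mult1.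
    - by exists (fun i => c i + d i); rewrite lincombD -ac -bd gmulfM.
    - by exists (fun i => - c i); rewrite lincombN -ac multV.
  rewrite mem_cat => /orP[/codomP[j ->]|/tD/fD ->].
    by exists (fun i => (i == j)%:Z); rewrite lincomb_delta gx.
  by exists (fun=> 0); rewrite lincomb0.
have [|x [i [[g gG gx] xi]]] :=
  nielsen_zero Pmove (y := tnth (in_tuple y) : _ -> additive Vc) lt_ys _
    (generates_lincomb (fun=> erefl) yV) Pspan.
  exists (fun i => f (tnth (in_tuple s) i)), (tnth (in_tuple s)) => //.
  apply: eq_generates stG => z; rewrite !mem_cat; congr (_ || _).
  by apply/(tnthP (in_tuple s))/codomP.
exists [seq g j | j <- rem i (enum 'I_(size s))], (g i :: t); split=> //.
- rewrite size_map size_rem ?mem_enum // size_enum_ord prednK //.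
  exact: leq_ltn_trans lt_ys.
- apply: eq_generates gG => z; rewrite !mem_cat inE orbA; congr (_ || _).
  by rewrite codomE (perm_mem (perm_map g (perm_to_rem (mem_enum _ i)))) /= inE orbC.
- move=> z; rewrite inE => /orP[/eqP->|/tD//].
  by apply/fD; rewrite gx xi.
Qed.

Lemma kill_generators G V (f : {multiplicative G -> V}) (y : seq V) (s : seq G) :
    abelianizes f -> generates y -> generates s -> (size y <= size s)%N ->
  exists s' t', [/\ size s' = size y, (size s' + size t' = size s)%N,
    generates (s' ++ t') &
    forall x, x \in t' -> normal_carrier (commutator_subgroup G) x].
Proof.
move=> fA yV sG.
suff H m (t : seq G) s1 : generates (s1 ++ t) ->
    (forall x, x \in t -> normal_carrier (commutator_subgroup G) x) ->
    size s1 = (size y + m)%N ->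
    exists s' t', [/\ size s' = size y, (size s' + size t' = size s1 + size t)%N,
    generates (s' ++ t') &
    forall x, x \in t' -> normal_carrier (commutator_subgroup G) x].
  move=> ys; have := H (size s - size y)%N [::] s.
  by rewrite cats0 subnKC // addn0; apply.
elim: m t s1 => [|m IH] t s1 tG tD s1E.
  by exists s1, t; rewrite s1E addn0.
have [|s2 [t2 [s2E t2E s2G t2D]]] := kill_generator fA yV _ tG tD.
  by rewrite s1E -addSnnS leq_addr.
have [|s' [t' [s'E s't' ? ?]]] := IH t2 s2 s2G t2D.
  by apply/eq_add_S; rewrite s2E s1E addnS.
by exists s', t'; split=> //; rewrite s't' t2E -s2E addSnnS.
Qed.

End Nielsen.

(** * Minima and the two bounds *)

Section Bounds.
Local Open Scope classical_set_scope.
Implicit Types G H K L V : groupType.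

Lemma minimum_exists (P : set nat) : (exists n, P n) -> exists n, is_minimum P n.
Proof.
move=> [n Pn]; have exP : exists n, `[< P n >] by exists n; apply/asboolP.
case: (ex_minnP exP) => m /asboolP Pm mmin; exists m; split=> // k Pk.
by apply: mmin; apply/asboolP.
Qed.

Lemma fset_of_seq (T : choiceType) (s : seq T) :
  exists2 A : {fset T}, [set` A] = [set` s] & (#|` A| <= size s)%N.
Proof.
exists [fset x in s]%fset; last by rewrite card_fseq size_undup.
by apply/seteqP; split=> x /=; rewrite inE.
Qed.

Lemma rank_generates G r : is_rank G r -> exists2 s : seq G, size s = r & generates s.
Proof. by case=> [[A Ar AG] _]; exists (enum_fset A). Qed.

Lemma rank_min G r (s : seq G) : is_rank G r -> generates s -> (r <= size s)%N.
Proof.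
have [A As sA] := fset_of_seq s.
by move=> [_ rmin] sG; apply: leq_trans sA; apply: rmin; exists A; rewrite // As.
Qed.

Lemma rank_exists G (s : seq G) : generates s -> exists r, is_rank G r.
Proof.
have [A As _] := fset_of_seq s.
by move=> sG; apply: minimum_exists; exists #|` A|%fset, A; rewrite // As.
Qed.

Lemma MaQiu_generates G a : is_MaQiu_index G a ->
  exists2 s : seq G, size s = a & commutator_normally_generated_by s.
Proof.
by case=> [[A [Aa AD /seteqP[_ DA]]] _]; exists (enum_fset A).
Qed.

Lemma MaQiu_fset G (s : seq G) : commutator_normally_generated_by s ->
  exists A : {fset G}, [/\ (#|` A| <= size s)%N, [set` A] `<=` commutator_subgroup G &
        normal_closure [set` A] = commutator_subgroup G :> set G].
Proof.
have [A As sA] := fset_of_seq s; move=> [sD Ds]; exists A; rewrite As; split=> //.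
by apply/seteqP; split=> //; exact: normal_closure_min.
Qed.

Lemma MaQiu_min G a (s : seq G) :
  is_MaQiu_index G a -> commutator_normally_generated_by s -> (a <= size s)%N.
Proof.
move=> [_ amin] /MaQiu_fset[A [sA AD DA]].
by apply: leq_trans sA; apply: amin; exists A.
Qed.

Lemma MaQiu_exists G (s : seq G) : generates s -> exists a, is_MaQiu_index G a.
Proof.
move=> sG; have /MaQiu_fset[A [_ AD DA]] :
    commutator_normally_generated_by ([::] ++ commutator_pairs s).
  by apply: MaQiu_of_generators; rewrite ?cats0.
by apply: minimum_exists; exists #|` A|%fset, A.
Qed.

(** The generators of [kill_generators] give r - h + h(h-1)/2 normal generators of
the commutator subgroup. *)
Lemma MaQiu_bound G V (f : {multiplicative G -> V}) a r h :
  abelianizes f -> is_MaQiu_index G a -> is_rank G r -> is_rank V h ->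
  (a + h <= r + 'C(h, 2))%N.
Proof.
move=> fA Ga Gr Vh; have [s sr sG] := rank_generates Gr.
have [y yh yV] := rank_generates Vh.
have le_hr : (h <= r)%N.
  by rewrite -sr -(size_map f); apply: rank_min Vh _; apply: generates_image; case: fA.
rewrite -yh -sr in le_hr.
have [s' [t [s'E stE stG tD]]] := kill_generators fA yV sG le_hr.
have := MaQiu_min Ga (MaQiu_of_generators stG tD).
by rewrite size_cat size_commutator_pairs s'E yh; lia.
Qed.

Lemma MaQiu_le_converts G G' n a a' : is_MaQiu_index G a -> is_MaQiu_index G' a' ->
  converts_in n G G' -> (a' <= a + n)%N.
Proof.
move=> Ga G'a' c; have [s sa sP] := MaQiu_generates Ga.
by have [s' s'E /(MaQiu_min G'a')] := MaQiu_converts c sP; rewrite s'E sa.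
Qed.

(** The path runs from G down to the common abelianization V and back up to G'. *)
Lemma converts_in_MaQiu G G' V (f : {multiplicative G -> V})
    (f' : {multiplicative G' -> V}) a a' :
  abelianizes f -> abelianizes f' -> is_MaQiu_index G a -> is_MaQiu_index G' a' ->
  converts_in (a + a') G G'.
Proof.
move=> fA f'A /MaQiu_generates[s <- sP] /MaQiu_generates[s' <- s'P].
apply: converts_in_trans (converts_in_abelianization fA sP) _.
exact: converts_in_sym (converts_in_abelianization f'A s'P).
Qed.

End Bounds.

Theorem corollary4 (G G' : groupType) :
  finitely_generated G -> finitely_generated G' ->
  isomorphic (abelianization G) (abelianization G') ->
  exists a a' r r' h d : nat,
    (is_MaQiu_index G a /\ is_MaQiu_index G' a') /\
    (is_rank G r /\ is_rank G' r' /\ is_rank (abelianization G) h) /\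
    is_presentation_distance G G' d /\
    `|a%:Z - a'%:Z| <= d%:Z <= r%:Z + r'%:Z + h%:Z * (h%:Z - 3).
Proof.
move=> [A AG] [A' A'G] /isomorphic_sym[i iB].
have fA : abelianizes (quotient_proj (commutator_subgroup G)).
  exact: quotient_map_proj.
have f'A : abelianizes (i \o quotient_proj (commutator_subgroup G')).
  by apply: quotient_map_iso iB; exact: quotient_map_proj.
have sG : generates (enum_fset A) := AG; have s'G : generates (enum_fset A') := A'G.
have [a Ga] := MaQiu_exists sG; have [a' G'a'] := MaQiu_exists s'G.
have [r Gr] := rank_exists sG; have [r' G'r'] := rank_exists s'G.
have [h Vh] := rank_exists (generates_image fA.1 sG).
have caa' := converts_in_MaQiu fA f'A Ga G'a'.
have [d Gd] : exists d, is_presentation_distance G G' d.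
  by apply: minimum_exists; exists (a + a')%N.
exists a, a', r, r', h, d; do !split=> //.
have [cd /(_ _ caa') d_le] := Gd.
have a'_le := MaQiu_le_converts Ga G'a' cd.
have a_le := MaQiu_le_converts G'a' Ga (converts_in_sym cd).
have := MaQiu_bound fA Ga Gr Vh; have := MaQiu_bound f'A G'a' G'r' Vh.
have : ('C(h, 2) * 2 = h * h.-1)%N
  by rewrite -[2%N in LHS]/(2`!) bin_ffact ffactnS ffactn1.
case: {Vh}h => [|h] /=; nia.
Qed.
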